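(* Let $p$ be a prime with $p\equiv5\pmod 6$, and let $\alpha\ge0$, $n\ge0$ be integers. Then for every $i\in\{1,2,\dots,p-1\}$, $$\overline{S_9}\big(6p^{2\alpha+2}n+(6i+3p)p^{2\alpha+1}\big)\equiv0\pmod 3.$$
   Context: For $|q|<1$ and a positive integer $k$, write $f_k=\prod_{j\ge1}(1-q^{kj})$. The function $\overline{S_9}(n)$ (number of $9$-Schur overpartitions of $n$) is defined by $\sum_{n\ge0}\overline{S_9}(n)q^n=\prod_{n\ge1}\frac{(1+q^{2n-1})(1-q^{9(2n-1)})}{(1+q^{9(2n-1)})(1-q^{2n-1})}=\frac{f_2^3f_9^2f_{36}}{f_1^2f_4f_{18}^3}$. *)

(* Defs.v *)
From mathcomp Require Import all_boot all_order all_algebra.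

Set Implicit Arguments.
Unset Strict Implicit.
Unset Printing Implicit Defensive.

Import GRing.Theory.
Local Open Scope ring_scope.

(* A formal power series \sum_n f n * q^n is represented by its sequence of
   coefficients f : nat -> R. *)
Section Series.
Variable R : comUnitRingType.
Implicit Types (f g h : nat -> R) (F : nat -> nat -> R).

Definition sone : nat -> R := fun n => (n == 0%N)%:R.

(* 1 + c q^m *)
Definition sbinom (c : R) (m : nat) : nat -> R :=
  fun n => (n == 0%N)%:R + c * (n == m)%:R.

Definition smul f g : nat -> R := fun n => \sum_(i < n.+1) f i * g (n - i)%N.

(* The first n coefficients of 1 / f, each obtained from the previous ones by
   solving f * g = 1 in degree n; meaningful when f 0 is a unit (see smulV). *)
Fixpoint sinv_seq f (n : nat) : seq R :=
  if n is m.+1 then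
    let s := sinv_seq f m in
    rcons s ((f 0%N)^-1 * ((m == 0%N)%:R - \sum_(i < m) s`_i * f (m - i)%N))
  else [::].

Definition sinv f : nat -> R := fun n => (sinv_seq f n.+1)`_n.

Definition sdiv f g : nat -> R := smul f (sinv g).

Fixpoint spartial F (N : nat) : nat -> R :=
  if N is M.+1 then smul (spartial F M) (F N) else sone.

(* The infinite product of the F k, k >= 1, converges coefficientwise to g. *)
Definition is_sprod F g : Prop :=
  forall n, exists N0, forall N, (N0 <= N)%N -> spartial F N n = g n.

(* The infinite product itself, when F k = 1 + O(q^k) for all k >= 1: the
   coefficient of q^n is then that of the n-th partial product (see sprodP). *)
Definition sprod F : nat -> R := fun n => spartial F n n.

Lemma size_sinv_seq f n : size (sinv_seq f n) = n.
Proof. by elim: n => //= n IHn; rewrite size_rcons IHn. Qed.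

Lemma nth_sinv_seq f n i : (i < n)%N -> (sinv_seq f n)`_i = sinv f i.
Proof.
elim: n => // n IHn; rewrite ltnS leq_eqVlt => /predU1P[-> // | lt_in].
by rewrite [sinv_seq _ _]/= nth_rcons size_sinv_seq lt_in IHn.
Qed.

Lemma sinvE f n :
  sinv f n = (f 0%N)^-1 *
             ((n == 0%N)%:R - \sum_(i < n) sinv f i * f (n - i)%N).
Proof.
rewrite {1}/sinv [sinv_seq _ _]/= nth_rcons size_sinv_seq ltnn eqxx.
by congr (_ * (_ - _)); apply: eq_bigr => i _; rewrite nth_sinv_seq.
Qed.

Lemma smulC f g : smul f g =1 smul g f.
Proof.
move=> n; rewrite /smul (reindex_inj rev_ord_inj) /=.
apply: eq_bigr => i _; rewrite subSS mulrC subKn //.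
by rewrite -ltnS.
Qed.

Lemma smulV f : f 0%N \is a GRing.unit -> smul f (sinv f) =1 sone.
Proof.
move=> Uf n; rewrite smulC /smul big_ord_recr /= subnn (sinvE f n).
by rewrite mulrAC mulVr // mul1r addrC subrK.
Qed.

(* f = 1 + O(q^k) *)
Definition near1 (k : nat) f : Prop := forall n, (n < k)%N -> f n = sone n.

Lemma smul_near1r k f g n : near1 k g -> (n < k)%N -> smul f g n = f n.
Proof.
move=> g1 ltnk; rewrite /smul big_ord_recr /= subnn g1 ?(leq_ltn_trans _ ltnk) //.
rewrite big1 ?add0r ?mulr1 // => i _.
rewrite g1 ?(leq_ltn_trans (leq_subr _ _)) // /sone subn_eq0 leqNgt ltn_ord.
by rewrite mulr0.
Qed.

Lemma sprodP F :
  (forall k, (0 < k)%N -> near1 k (F k)) -> is_sprod F (sprod F).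
Proof.
move=> F1 n; exists n => N /subnK <-; elim: (N - n)%N => // d IHd.
by rewrite addSn /= (smul_near1r _ (F1 _ _)) // ltnS leq_addl.
Qed.

Lemma near1_smul k f g : near1 k f -> near1 k g -> near1 k (smul f g).
Proof. by move=> f1 g1 n ltnk; rewrite (smul_near1r _ g1) ?f1. Qed.

Lemma near1_sinv k f : (0 < k)%N -> near1 k f -> near1 k (sinv f).
Proof.
move=> k_gt0 f1 n ltnk.
have Uf : f 0%N \is a GRing.unit by rewrite f1 // unitr1.
by rewrite -(smulV Uf) smulC (smul_near1r _ f1).
Qed.

Lemma near1_sbinom k c m : (k <= m)%N -> near1 k (sbinom c m).
Proof.
move=> lekm n ltnk; rewrite /sbinom (ltn_eqF (leq_trans ltnk lekm)).
by rewrite mulr0 addr0.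
Qed.

End Series.

(* (1 + q^m) (1 - q^(9m)) / ((1 + q^(9m)) (1 - q^m)) with m = 2 k - 1 *)
Definition S9_factor (k : nat) : nat -> int :=
  let m := (2 * k - 1)%N in
  sdiv (smul (sbinom 1 m) (sbinom (-1) (9 * m)%N))
       (smul (sbinom 1 (9 * m)%N) (sbinom (-1) m)).

(* The number of 9-Schur overpartitions of n. *)
Definition S9 : nat -> int := sprod S9_factor.

Lemma S9_factor_near1 k : (0 < k)%N -> near1 k (S9_factor k).
Proof.
move=> k_gt0; have lek : (k <= 2 * k - 1)%N.
  by rewrite mul2n -addnn -addnBA // leq_addr.
have lek9 : (k <= 9 * (2 * k - 1))%N by rewrite (leq_trans lek) // leq_pmull.
by apply: near1_smul; last apply: near1_sinv => //;
  apply: near1_smul; apply: near1_sbinom.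
Qed.

Lemma S9_is_sprod : is_sprod S9_factor S9.
Proof. exact: sprodP S9_factor_near1. Qed.

(* Main.v *)
Require Import Defs.
From mathcomp Require Import all_boot all_order all_algebra all_field.
From mathcomp Require Import ring zify.

(* Let a = \sum_k q^(k^2) and b = \sum_k (-1)^k q^(k^2), k ranging over Z, and
   work modulo 3.  Since 1 +- q^(9m) = (1 +- q^m)^9, the generating function G of
   S9 is the eighth power of \prod_(m odd) (1 - q^m) / (1 + q^m), that is b^4 / a^4
   by the Jacobi triple product.  As f(q)^3 = f(q^3), the coefficients of
   a^4 + b^4 = a(q) a(q^3) + b(q) b(q^3) count twice the pairs (x, y) with
   x = y mod 2 and x^2 + 3 y^2 = N; the rotation of order 3 of the Eisenstein
   integers acts freely on them when N > 0, so a^4 + b^4 = 2 = -1.  Hence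
   G = -1 - a^-4 = -1 - a^2 / a(q^3)^2.  Because 3 | x^2 + y^2 forces 3 | x and
   3 | y, keeping the exponents divisible by 3 turns a^2 into a(q^9)^2 = a(q^3)^6,
   so \sum_n S9(3n) q^n = -1 - a^4 = -1 - a(q) a(q^3): for n > 0, S9(3n) is minus
   the number of representations of n by x^2 + 3 y^2.  There are none when a prime
   p = 5 mod 6 divides n to an odd power, -3 being a nonresidue modulo p. *)

Set Implicit Arguments.
Unset Strict Implicit.
Unset Printing Implicit Defensive.

Import Order.TTheory GRing.Theory Num.Theory.
Local Open Scope ring_scope.

(** * The form x^2 + 3 y^2 *)

(** If p did not divide y, x/y would be a square root of -3 and yield a primitive cube root of unity
    in ['F_p]; but cubing is injective there because p = 2 mod 3. *)
Lemma sqr_add3sqr_dvd (p x y : nat) : prime p -> (p %% 6 = 5)%N ->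
  (p %| x ^ 2 + 3 * y ^ 2 -> p %| x /\ p %| y)%N.
Proof.
move=> p_prime p_mod6; have charp := pchar_Fp p_prime.
have zeroE n : (p %| n)%N = (n%:R == 0 :> 'F_p) by rewrite (dvdn_pcharf charp).
rewrite !zeroE natrD natrM !natrX => /eqP xy0.
have p_gt4 : (4 < p)%N by move: (leq_mod p 6); rewrite p_mod6.
have small n : (0 < n)%N -> (n %| 12)%N -> (n%:R != 0 :> 'F_p).
  move=> n_gt0 n_dvd; rewrite -zeroE; apply/negP=> /dvdn_trans /(_ n_dvd).
  have : p \in iota 5 8 -> ~ (p %| 12)%N by rewrite !inE; lia.
  by move=> H p12; apply: (H _ p12); rewrite mem_iota; have := dvdn_leq (isT : (0 < 12)%N) p12; lia.
have [y0 | y_neq0] := eqVneq (y%:R : 'F_p) 0.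
  by move: xy0; rewrite y0 expr0n mulr0 addr0 => /eqP; rewrite expf_eq0.
have [t t2] : exists t : 'F_p, t ^+ 2 = -3.
  exists (x%:R / y%:R); rewrite expr_div_n; apply: (canLR (mulfK _)).
    by rewrite expf_neq0.
  by move: xy0 => /eqP; rewrite addr_eq0 mulNr => /eqP.
have fermat (z : 'F_p) : z ^+ (3 * (p %/ 3) + 2) = z.
  have <- : p = (3 * (p %/ 3) + 2)%N by lia.
  by rewrite -[RHS]expf_card card_Fp.
(* If [t^2 = -3] then [t - 1] is twice a cube root of unity. *)
have w3 : (t - 1) ^+ 3 = 2 ^+ 3.
  have -> : (t - 1) ^+ 3 = (t - 3) * t ^+ 2 + 3 * t - 1 by ring.
  by rewrite t2; ring.
(* Since t - 1 and 2 have the same cube, z^p = z for both, with p = 3k + 2, differs only in the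
   square factor; 2^(3k) then cancels. *)
have w2 : (t - 1) ^+ 2 * 2 = (t - 1) * 2 ^+ 2.
  have pw := fermat (t - 1); have p2 := fermat 2.
  rewrite exprD exprM w3 -exprM in pw; rewrite exprD in p2.
  have e2 : 2 ^+ (3 * (p %/ 3)) != 0 :> 'F_p by rewrite expf_neq0 // (small 2).
  apply: (mulfI e2); rewrite mulrA pw -{1}p2; ring.
have : 2 * (t - 1) * (t - 3) = 0.
  have -> : 2 * (t - 1) * (t - 3) = (t - 1) ^+ 2 * 2 - (t - 1) * 2 ^+ 2 by ring.
  by rewrite w2 subrr.
(* So t is 1 or 3, and t^2 + 3 = 0 becomes 4 = 0 or 12 = 0. *)
move/eqP; rewrite !mulf_eq0 (negPf (small 2%N _ _)) //= !subr_eq0.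
case/orP=> /eqP tE; move: t2; rewrite tE => /eqP; rewrite -subr_eq0 opprK.
- have -> : (1 ^+ 2 + 3 : 'F_p) = 4%:R by ring.
  by rewrite (negPf (small 4%N _ _)).
- have -> : (3 ^+ 2 + 3 : 'F_p) = 12%:R by ring.
  by rewrite (negPf (small 12%N _ _)).
Qed.

(** Descent: p divides x and y, so p^2 cancels and the exponent drops by 2; at exponent 1 this
    leaves p | m. *)
Lemma not_sqr_add3sqr (p a m x y : nat) : prime p -> (p %% 6 = 5)%N ->
  ~~ (p %| m)%N -> (x ^ 2 + 3 * y ^ 2 != p ^ (2 * a + 1) * m)%N.
Proof.
move=> p_prime p_mod6 pNm; elim: a x y => [|a IHa] x y; apply/eqP => xyE;
  have := sqr_add3sqr_dvd p_prime p_mod6 (x := x) (y := y);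
  rewrite xyE addnS expnS -mulnA dvdn_mulr // => /(_ isT) [] /dvdnP[x' xE] /dvdnP[y' yE];
  have p_gt0 := prime_gt0 p_prime.
- suff : (p %| m)%N by apply/negP.
  apply/dvdnP; exists (x' ^ 2 + 3 * y' ^ 2)%N; apply/eqP; rewrite -(eqn_pmul2l p_gt0).
  by apply/eqP; move: xyE; rewrite xE yE muln0 add0n expn1 => <-; ring.
- have := IHa x' y'; rewrite -(eqn_pmul2l p_gt0) -(eqn_pmul2l p_gt0).
  move/eqP; apply; move: xyE; rewrite xE yE.
  have -> : (2 * a.+1 + 1 = (2 * a + 1).+2)%N by lia.
  by rewrite !expnS -!mulnA => <-; ring.
Qed.

Lemma dvd3_card_free (T : finType) (f : T -> T) (A : {set T}) :
    {in A, forall x, f x \in A} -> {in A, forall x, f (f (f x)) = x} ->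
    {in A, forall x, f x != x} ->
  (3 %| #|A|)%N.
Proof.
have [n] := ubnP #|A|; elim: n A => // n IHn A leAn fA f3 fN.
have [-> | [x xA]] := set_0Vmem A; first by rewrite cards0.
pose B := [set x; f x; f (f x)].
have fxA := fA x xA; have ffxA := fA _ fxA.
have cB : #|B| = 3.
  rewrite /B setUC cardsU1 cards2 !inE negb_or (fN _ fxA) (eq_sym x) (fN x xA).
  by rewrite (_ : f (f x) == x = false) //; apply: contraNF (fN _ ffxA); rewrite f3 // eq_sym.
have sBA : B \subset A.
  by apply/subsetP=> z; rewrite !inE => /orP[/orP[]|] /eqP->.
have cA : #|A| = (3 + #|A :\: B|)%N by rewrite -(cardsID B A) (setIidPr sBA) cB.
rewrite cA dvdn_addr //; apply: IHn; first by rewrite ltnS in leAn; lia.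
- move=> z; rewrite !in_setD => /andP[zB zA]; rewrite fA // andbT.
  apply: contra zB => fzB; rewrite -(f3 z zA).
  by move: fzB; rewrite !inE => /orP[/orP[]|] /eqP ->; rewrite ?(f3 x xA) ?eqxx ?orbT.
- by move=> z /setDP[/f3].
- by move=> z /setDP[/fN].
Qed.

(** * Gaussian binomials and truncated power series *)

(** The Gaussian binomial coefficient, by its Pascal rule rather than as a quotient, so that no
    division by 1 - Q^j occurs. *)
Fixpoint qbin (R : nzRingType) (Q : R) (n i : nat) : R :=
  match n, i with
  | _, 0 => 1
  | 0, _.+1 => 0
  | n'.+1, i'.+1 => qbin Q n' i' + Q ^+ i * qbin Q n' i
  end.

Lemma qbin0 (R : nzRingType) (Q : R) n : qbin Q n 0 = 1.
Proof. by case: n. Qed.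

Lemma qbin_small (R : nzRingType) (Q : R) n i : (n < i)%N -> qbin Q n i = 0.
Proof.
elim: n i => [|n IHn] [|i] //= lt_ni.
by rewrite !IHn ?mulr0 ?addr0 // ltnW.
Qed.

(** Induction on n: split off the factor j = 0 and replace x by x Q in the others. The homogeneous
    variable y later serves to centre the product. *)
Lemma qbin_thm (R : comNzRingType) (Q x y : R) n :
  \prod_(j < n) (y + x * Q ^+ j) =
  \sum_(i < n.+1) Q ^+ 'C(i, 2) * qbin Q n i * x ^+ i * y ^+ (n - i).
Proof.
elim: n x => [|n IHn] x; first by rewrite big_ord0 big_ord1 /= !mulr1.
rewrite big_ord_recl expr0 mulr1.
under eq_bigr => j _ do rewrite lift0 exprS mulrA.
rewrite IHn mulrDl [RHS]big_ord_recl /=.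
under [in RHS]eq_bigr => i _.
  rewrite /bump /= add1n subSS.
  have -> : Q ^+ 'C(i.+1, 2) * (qbin Q n i + Q ^+ i.+1 * qbin Q n i.+1) * x ^+ i.+1 * y ^+ (n - i)
    = Q ^+ 'C(i.+1, 2) * Q ^+ i.+1 * qbin Q n i.+1 * x ^+ i.+1 * y ^+ (n - i)
     + x * (Q ^+ 'C(i, 2) * qbin Q n i * (x * Q) ^+ i * y ^+ (n - i)).
    by rewrite binS bin1 exprD exprMn !exprS; ring.
  over.
rewrite big_split addrA -mulr_sumr /=; congr (_ + _).
rewrite [LHS]mulr_sumr [in LHS]big_ord_recl [in RHS]big_ord_recr /= (@qbin_small _ Q n n.+1) // mulr0 !mul0r addr0.
rewrite !expr0 !mulr1 !mul1r qbin0 mul1r !subn0 -exprS; congr (_ + _).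
apply: eq_bigr => i _; rewrite /bump /= add1n exprMn.
have -> : (n - i = (n - i.+1).+1)%N by have := ltn_ord i; lia.
by rewrite !exprS; ring.
Qed.

Lemma qbin_fact (R : comNzRingType) (Q : R) n i :
  \prod_(j < i) (1 - Q ^+ j.+1) * qbin Q n i = \prod_(j < i) (1 - Q ^+ (n - j)).
Proof.
elim: n i => [|n IHn] [|i]; rewrite ?big_ord0 ?mul1r ?qbin0 //.
  by rewrite mulr0 [RHS]big_ord_recl subrr mul0r.
rewrite [qbin _ _ _]/= mulrDr (mulrCA _ (Q ^+ _)) IHn [\prod_(j < i.+1) (1 - _ ^+ j.+1)]big_ord_recr /=.
rewrite mulrAC IHn [in RHS]big_ord_recl [in LHS]big_ord_recr subn0 /=.
under [in RHS]eq_bigr => j _ do rewrite /bump /= add1n subSS.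
have [le_in | lt_ni] := leqP i n.
  have -> : Q ^+ n.+1 = Q ^+ i.+1 * Q ^+ (n - i) by rewrite -exprD addSn subnKC.
  ring.
(* For i > n the factor j = n is 1 - Q^0 = 0. *)
rewrite (_ : \prod_(j < i) _ = 0); first by rewrite !mul0r !mulr0 addr0.
by rewrite (bigD1 (Ordinal lt_ni)) //= subnn subrr mul0r.
Qed.

Section Truncation.
Variable F : fieldType.
Implicit Types p q r : {poly F}.

Lemma dvdp_XnP n p : reflect (forall i, (i < n)%N -> p`_i = 0) ('X^n %| p).
Proof.
apply: (iffP idP) => [/dvdpP[q ->] i lt_in | p0]; first by rewrite coefMXn lt_in.
rewrite -(poly_take_drop n p) (_ : take_poly n p = 0) ?add0r ?dvdp_mulIr //.
by apply/polyP=> i; rewrite coef_take_poly coef0; case: ifP => // /p0.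
Qed.

(** Plays the role of equality of power series up to O(q^n); as a divisibility, it inherits
    cancellation from coprimality with X. *)
Definition eqX n p q := 'X^n %| p - q.

Lemma eqXP n p q : reflect (forall i, (i < n)%N -> p`_i = q`_i) (eqX n p q).
Proof.
apply: (iffP (dvdp_XnP _ _)) => pq i /pq; rewrite coefB => /eqP.
  by rewrite subr_eq0 => /eqP.
by move/eqP->; rewrite subrr.
Qed.

Lemma eqX_refl n p : eqX n p p.
Proof. by apply/eqXP. Qed.

Lemma eqX_sym n p q : eqX n p q -> eqX n q p.
Proof. by move/eqXP=> pq; apply/eqXP => i /pq. Qed.

Lemma eqX_trans n p q r : eqX n p q -> eqX n q r -> eqX n p r.
Proof. by move=> /eqXP pq /eqXP qr; apply/eqXP => i lt_in; rewrite pq ?qr. Qed.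

Lemma eqX_leq m n p q : (m <= n)%N -> eqX n p q -> eqX m p q.
Proof. by move=> le_mn /eqXP pq; apply/eqXP => i lt_im; apply/pq/(leq_trans lt_im). Qed.

Lemma eqXD n p q r s : eqX n p q -> eqX n r s -> eqX n (p + r) (q + s).
Proof. by move=> /eqXP pq /eqXP rs; apply/eqXP => i lt_in; rewrite !coefD pq ?rs. Qed.

Lemma eqXM n p q r s : eqX n p q -> eqX n r s -> eqX n (p * r) (q * s).
Proof.
move=> pq rs; rewrite /eqX (_ : _ - _ = (p - q) * r + q * (r - s)); last by ring.
by apply: dvdp_add; [apply: dvdp_mulr | apply: dvdp_mull].
Qed.

Lemma eqX_exp n p q k : eqX n p q -> eqX n (p ^+ k) (q ^+ k).
Proof. by move=> pq; elim: k => [|k IHk]; rewrite ?eqX_refl // !exprS eqXM. Qed.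

Lemma eqX_sum n (I : Type) (s : seq I) (P : pred I) (f g : I -> {poly F}) :
    (forall i, P i -> eqX n (f i) (g i)) ->
  eqX n (\sum_(i <- s | P i) f i) (\sum_(i <- s | P i) g i).
Proof. by move=> fg; apply: (big_ind2 (eqX n)) => // *; [apply: eqX_refl | apply: eqXD]. Qed.

Lemma eqX_prod n (I : Type) (s : seq I) (P : pred I) (f g : I -> {poly F}) :
    (forall i, P i -> eqX n (f i) (g i)) ->
  eqX n (\prod_(i <- s | P i) f i) (\prod_(i <- s | P i) g i).
Proof. by move=> fg; apply: (big_ind2 (eqX n)) => // *; [apply: eqX_refl | apply: eqXM]. Qed.

Lemma eqX_mulXn m n p q : eqX n p q -> eqX (m + n) ('X^m * p) ('X^m * q).
Proof. by move=> pq; rewrite /eqX -mulrBr exprD dvdp_mul. Qed.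

Lemma eqXMI n r p q : r`_0 != 0 -> eqX n (r * p) (r * q) -> eqX n p q.
Proof.
move=> r0; rewrite /eqX -mulrBr Gauss_dvdpr // coprimep_expl //.
by rewrite coprimep_sym -['X]subr0 -(polyC0 F) coprimep_XsubC /root horner_coef0.
Qed.

End Truncation.

(** * A finite form of the Jacobi triple product *)

Lemma mul2_bin2 n : (2 * 'C(n, 2) = n * (n - 1))%N.
Proof.
rewrite bin2 mul2n subn1 -[RHS]odd_double_half oddM.
by case: n => //= n; rewrite andNb.
Qed.

(** Completes the square in the exponent of X met in [qbin_thm] at Q = X^2, y = X^(2L-1), n = 2L.
    With truncated subtraction, [i - L + (L - i)] is |i - L|. *)
Lemma qbin_thm_expn L i : (0 < L)%N -> (i <= 2 * L)%N ->
  (2 * 'C(i, 2) + (2 * L - 1) * (2 * L - i) =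
   3 * L ^ 2 - 2 * L + (i - L + (L - i)) ^ 2)%N.
Proof.
move=> L_gt0 le_i; rewrite mul2_bin2.
have e1 : (i * (i - 1) + i = i * i)%N by case: i {le_i} => // i; rewrite subn1 -mulnSr.
have e2 : (3 * L ^ 2 - 2 * L + 2 * L = 3 * L * L)%N.
  have : (L <= L * L)%N by rewrite leq_pmulr.
  lia.
have e3 : ((2 * L - 1) * (2 * L - i) + (2 * L - i) = 2 * L * (2 * L - i))%N.
  by rewrite -mulSnr; congr (_ * _)%N; lia.
have [le_iL | /ltnW le_Li] := leqP i L.
  have [d Ld] : exists d, L = (i + d)%N by exists (L - i)%N; lia.
  have E1 : (2 * L - i = i + 2 * d)%N by lia.
  have E2 : (i - L + (L - i) = d)%N by lia.
  rewrite E1 in e3 *; rewrite E2; subst L; lia.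
have [d id] : exists d, i = (L + d)%N by exists (i - L)%N; lia.
have [e dL] : exists e, L = (d + e)%N by exists (L - d)%N; lia.
have E1 : (2 * L - i = e)%N by lia.
have E2 : (i - L + (L - i) = d)%N by lia.
rewrite E1 in e3 *; rewrite E2; subst i; subst L; lia.
Qed.

Section Theta.
Variable F : fieldType.
Implicit Types z : F.

(** With i = k + L, this is the sum of z^(k+L) q^(k^2) over |k| <= L. At z = -1 it carries an extra
    sign (-1)^L, which disappears in fourth powers. *)
Definition theta (L : nat) z : {poly F} :=
  \sum_(i < (2 * L).+1) z ^+ i *: 'X^(((i - L) + (L - i)) ^ 2).

Definition odd_prod (L : nat) z : {poly F} := \prod_(j < L) (1 + z *: 'X^(2 * j + 1)).

(** By [qbin_fact] the left side is a product of factors 1 - X^(2k), each with k > i or k > 2L -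
    i. *)
Lemma eqX_qbin (L i : nat) : (i <= 2 * L)%N ->
  eqX (2 * minn i (2 * L - i)).+1
    (\prod_(j < 2 * L) (1 - 'X^2 ^+ j.+1) * qbin 'X^2 (2 * L) i) (1 : {poly F}).
Proof.
move=> le_i; set m := (2 * _).+1.
have eq1 k : (m <= 2 * k)%N -> eqX m (1 - 'X^2 ^+ k) (1 : {poly F}).
  move=> le_mk; apply/eqXP => d lt_dm; rewrite -exprM !coefE.
  by rewrite (ltn_eqF (leq_trans lt_dm le_mk)) subr0.
have -> : (2 * L = i + (2 * L - i))%N by rewrite subnKC.
rewrite big_split_ord /= mulrAC qbin_fact -[X in eqX _ _ X]mulr1.
have mul1 p q : eqX m p 1 -> eqX m q 1 -> eqX m (p * q) (1 : {poly F}).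
  by move=> p1 q1; rewrite -[X in eqX _ _ X]mulr1; apply: eqXM.
apply: eqXM; apply: (big_ind (fun p => eqX m p 1)) => [|//|j _];
  first [exact: eqX_refl | idtac].
all: by apply: eq1; move: (ltn_ord j); rewrite /m; lia.
Qed.

(** The q-binomial theorem with Q = X^2, x = z, y = X^(2L-1) and 2L factors: each half of the
    product is [odd_prod] up to a monomial, and X^(3L^2-2L) cancels on both sides. *)
Lemma odd_prod_sqr L z : z ^+ 2 = 1 ->
  z ^+ L *: odd_prod L z ^+ 2 =
  \sum_(i < (2 * L).+1) z ^+ i *: ('X^(((i - L) + (L - i)) ^ 2) * qbin 'X^2 (2 * L) i).
Proof.
move=> z2.
case: L => [|L0]; first by rewrite big_ord1 /odd_prod big_ord0 /= !expr1n mulr1.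
set L := L0.+1; have := qbin_thm 'X^2 z%:P 'X^(2 * L - 1) (2 * L).
have -> : \prod_(j < 2 * L) ('X^(2 * L - 1) + z%:P * 'X^2 ^+ j) =
   'X^(3 * L ^ 2 - 2 * L) * (z ^+ L *: odd_prod L z ^+ 2).
  have prod2 (f : nat -> {poly F}) :
      \prod_(j < 2 * L) f j = \prod_(j < L) f j * \prod_(j < L) f (L + j)%N.
    by rewrite mul2n -addnn big_split_ord.
  rewrite (prod2 (fun j => 'X^(2 * L - 1) + z%:P * 'X^2 ^+ j)).
  (* Lower half: as z^2 = 1, z X^(2j) can be pulled out of each factor, leaving the factors of
     [odd_prod] in reverse order. *)
  have -> : \prod_(j < L) ('X^(2 * L - 1) + z%:P * 'X^2 ^+ j) =
      'X^(L * (L - 1)) * (z ^+ L *: odd_prod L z).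
    have -> : (L * (L - 1) = \sum_(j < L) 2 * j)%N.
      by rewrite -big_distrr /= -(big_mkord xpredT id) bin2_sum mul2_bin2.
    rewrite -mul_polyC expr_sum /odd_prod [\prod_(j < L) (1 + _)](reindex_inj rev_ord_inj) /=.
    have -> : (z ^+ L)%:P = \prod_(j < L) z%:P by rewrite prodr_const card_ord polyC_exp.
    rewrite -!big_split /=; apply: eq_bigr => j _.
    have jL := ltn_ord j.
    have -> : (2 * L - 1 = 2 * j + (2 * (L - j.+1) + 1))%N by lia.
    have zz : z%:P * z%:P = 1 :> {poly F} by rewrite -polyCM -expr2 z2.
    rewrite -!exprM -mul_polyC !(exprD _ (2 * j)).
    transitivity ('X^(2 * j) * (z%:P + z%:P * z%:P * 'X^(2 * (L - j.+1) + 1))); last by ring.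
    by rewrite zz; ring.
  have -> : \prod_(j < L) ('X^(2 * L - 1) + z%:P * 'X^2 ^+ (L + j)) =
      'X^((2 * L - 1) * L) * odd_prod L z.
    have -> : 'X^((2 * L - 1) * L) = \prod_(j < L) 'X^(2 * L - 1) :> {poly F}.
      by rewrite prodr_const card_ord exprM.
    rewrite -big_split /=; apply: eq_bigr => j _.
    rewrite -exprM (_ : (2 * (L + j) = (2 * L - 1) + (2 * j + 1))%N); last by lia.
    by rewrite exprD -mul_polyC; ring.
  rewrite (_ : (3 * L ^ 2 - 2 * L = L * (L - 1) + (2 * L - 1) * L)%N); last by nia.
  by rewrite exprD -!mul_polyC; ring.
have -> : \sum_(i < (2 * L).+1) 'X^2 ^+ 'C(i, 2) * qbin 'X^2 (2 * L) i * z%:P ^+ i * 'X^(2 * L - 1) ^+ (2 * L - i)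
 = 'X^(3 * L ^ 2 - 2 * L) * \sum_(i < (2 * L).+1) z ^+ i *: ('X^(((i - L) + (L - i)) ^ 2) * qbin 'X^2 (2 * L) i).
  rewrite mulr_sumr; apply: eq_bigr => i _.
  rewrite -mul_polyC -polyC_exp -!exprM.
  have E := qbin_thm_expn (isT : 0 < L)%N (ltn_ord i : i <= 2 * L)%N.
  have -> : 'X^(2 * 'C(i, 2)) * qbin 'X^2 (2 * L) i * (z ^+ i)%:P * 'X^((2 * L - 1) * (2 * L - i)) = 
    'X^(2 * 'C(i, 2) + (2 * L - 1) * (2 * L - i)) * qbin 'X^2 (2 * L) i * (z ^+ i)%:P.
    by rewrite exprD; ring.
  by rewrite E exprD; ring.
by move/mulfI; apply; rewrite expf_neq0 ?polyX_eq0.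
Qed.

(** Put d = |i - L|. Replacing the Gaussian binomial by 1 in term i costs an error of order d^2 +
    2(L - d) + 1, which is at least L + 1 since d <= d^2 and d <= L. *)
Lemma eqX_triple_product L z : z ^+ 2 = 1 ->
  eqX L.+1 (\prod_(j < 2 * L) (1 - 'X^2 ^+ j.+1) * (z ^+ L *: odd_prod L z ^+ 2))
    (theta L z).
Proof.
move=> z2; rewrite odd_prod_sqr // mulr_sumr; apply: eqX_sum => i _.
rewrite -!mul_polyC mulrCA; apply: eqXM (eqX_refl _ _) _.
rewrite mulrCA -[X in eqX _ _ X]mulr1.
have leiL : (i <= 2 * L)%N := ltn_ord i.
apply: eqX_leq (eqX_mulXn _ (eqX_qbin leiL)).
set d := (_ - _ + _)%N.
have : (L = d + minn i (2 * L - i))%N by rewrite /d; lia.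
have : (d <= d ^ 2)%N by case: (d) => // e; rewrite leq_pmulr.
by lia.
Qed.

End Theta.

(** * Theta series modulo 3 *)

Lemma poly3_eq0 : 3 = 0 :> {poly 'F_3}.
Proof. by rewrite -(polyC_natr _ 3) (_ : 3%:R = 0 :> 'F_3) //; apply/val_inj. Qed.

Lemma cubeDF3 (p q : {poly 'F_3}) : (p + q) ^+ 3 = p ^+ 3 + q ^+ 3.
Proof.
have -> : (p + q) ^+ 3 = p ^+ 3 + q ^+ 3 + 3 * (p ^+ 2 * q + p * q ^+ 2) by ring.
by rewrite poly3_eq0 mul0r addr0.
Qed.

Lemma cubeF3 (c : 'F_3) : c ^+ 3 = c.
Proof. by rewrite -[RHS]expf_card card_Fp. Qed.

Lemma cube_polyF3 (p : {poly 'F_3}) : p ^+ 3 = p \Po 'X^3.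
Proof.
elim/poly_ind: p => [|p c IHp]; first by rewrite comp_poly0 expr0n.
by rewrite cubeDF3 exprMn IHp -polyC_exp cubeF3 comp_polyD comp_polyM comp_polyC comp_polyX.
Qed.

(** Three of the four factors are merged by Frobenius into one series in X^3, whence the form x^2 +
    3 y^2. *)
Lemma theta_exp4 L (z : 'F_3) :
  theta L z ^+ 4 = \sum_(ij : 'I_(2 * L).+1 * 'I_(2 * L).+1)
    z ^+ (ij.1 + ij.2) *: 'X^((ij.1 - L + (L - ij.1)) ^ 2 + 3 * (ij.2 - L + (L - ij.2)) ^ 2).
Proof.
rewrite exprS cube_polyF3 {1}/theta mulr_suml -(pair_bigA _ (fun i j : 'I__ =>
  z ^+ (i + j) *: 'X^((i - L + (L - i)) ^ 2 + 3 * (j - L + (L - j)) ^ 2))) /=.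
apply: eq_bigr => i _; rewrite raddf_sum mulr_sumr; apply: eq_bigr => j _ /=.
rewrite comp_polyZ comp_Xn_poly -exprM -!mul_polyC !exprD polyCM; ring.
Qed.

(** The rotation of order 3 in coordinates shifted by L, without halving or subtraction. Being
    linear, these equations give order 3 and the unique fixed point (L, L) by linear arithmetic. *)
Definition rot_spec L (ij kl : nat * nat) :=
  [/\ 2 * kl.1 + (ij.1 + 3 * ij.2) = 6 * L & 2 * kl.2 + ij.2 = 2 * L + ij.1]%N.

Lemma int_dist_sqr (i L : nat) : ((i - L + (L - i)) ^ 2)%:Z = (i%:Z - L%:Z) ^+ 2.
Proof.
by have [le|/ltnW le] := leqP i L; rewrite (eqP le) ?add0n ?addn0 -mulnn PoszM -subzn //; ring.
Qed.

(* Multiplication of [x + y sqrt(-3)], [x = i - L], [y = j - L], by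
   [(-1 + sqrt(-3)) / 2]. *)
Lemma rot_exists L n (i j : nat) : (n <= L)%N -> ~~ odd (i + j) ->
    ((i - L + (L - i)) ^ 2 + 3 * (j - L + (L - j)) ^ 2 = n)%N ->
  exists k l, [/\ rot_spec L (i, j) (k, l), (k <= 2 * L)%N, (l <= 2 * L)%N, ~~ odd (k + l)
     & ((k - L + (L - k)) ^ 2 + 3 * (l - L + (L - l)) ^ 2 = n)%N].
Proof.
move=> le_nL ev qn.
have small (x : int) : x ^+ 2 <= n%:Z -> - L%:Z <= x <= L%:Z.
  move=> x2; have x_le : `|x| <= x ^+ 2.
    rewrite -real_normK ?num_real // expr2; case: (`|x|) (normr_ge0 x) => // -[|m] // _.
    by rewrite ler_peMr.
  by clear -x2 x_le le_nL; lia.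
set x := i%:Z - L%:Z; set y := j%:Z - L%:Z.
(* Equal parity makes s = (x - y)/2 an integer; the rotated point is (-(2y + s), s). *)
have [s sE] : exists s : int, x = y + 2 * s by exists ((i%:Z - j%:Z) %/ 2)%Z; rewrite /x /y; clear -ev; lia.
have q : x ^+ 2 + 3 * y ^+ 2 = n%:Z by rewrite -qn PoszD PoszM !int_dist_sqr.
have q' : (2 * y + s) ^+ 2 + 3 * s ^+ 2 = n%:Z by rewrite -q sE; ring.
have b1 : - L%:Z <= 2 * y + s <= L%:Z.
  by apply: small; rewrite -q' lerDl mulr_ge0 // sqr_ge0.
have b2 : - L%:Z <= s <= L%:Z.
  by apply: small; rewrite -q'; have := sqr_ge0 (2 * y + s); have := sqr_ge0 s; clear; lia.
have [k kE] : exists k : nat, k%:Z = L%:Z - (2 * y + s).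
  by exists (absz (L%:Z - (2 * y + s))%R); clear -b1; lia.
have [l lE] : exists l : nat, l%:Z = L%:Z + s.
  by exists (absz (L%:Z + s)%R); clear -b2; lia.
exists k, l; split; rewrite /rot_spec /=; try (clear -kE lE sE b1 b2; lia).
apply/eqP; rewrite -eqz_nat PoszD PoszM !int_dist_sqr kE lE -q'; apply/eqP.
by ring.
Qed.

Lemma theta_exp4D L : eqX L.+1 (theta L 1 ^+ 4 + theta L (-1 : 'F_3) ^+ 4) (-1).
Proof.
apply/eqXP => n; rewrite ltnS => le_nL; rewrite !theta_exp4 -big_split /= coef_sum.
pose q (ij : 'I_(2 * L).+1 * 'I_(2 * L).+1) :=
  ((ij.1 - L + (L - ij.1)) ^ 2 + 3 * (ij.2 - L + (L - ij.2)) ^ 2)%N.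
(* Pairs of odd sum cancel between the two fourth powers; those of even sum count twice. *)
pose A := [set ij : 'I_(2 * L).+1 * 'I_(2 * L).+1 | ~~ odd (ij.1 + ij.2) & q ij == n].
have -> : \sum_(ij : 'I_(2 * L).+1 * 'I_(2 * L).+1) (1 ^+ (ij.1 + ij.2) *: 'X^(q ij) + (-1 : 'F_3) ^+ (ij.1 + ij.2) *: 'X^(q ij))`_n
    = \sum_(ij in A) (2 : 'F_3).
  rewrite [RHS]big_mkcond /=; apply: eq_bigr => ij _.
  rewrite coefD !coefZ coefXn expr1n -signr_odd inE (eq_sym n).
  by case: (q ij == n); case: odd; rewrite /= ?mulr0 ?addr0 ?expr0 ?expr1 ?mulr1 // subrr.
rewrite sumr_const coefN coef1; have [n0 | n_gt0] := posnP n.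
  have Lin : (L < (2 * L).+1)%N by lia.
  have -> : A = [set (Ordinal Lin, Ordinal Lin)].
    apply/setP => -[i j]; rewrite !inE n0 /q /= xpair_eqE -!val_eqE /=.
    apply/andP/andP => [[_] | [/eqP-> /eqP->]]; last by rewrite subnn addnn odd_double; split.
    by rewrite addn_eq0 muln_eq0 /= !expn_eq0 /= !addn_eq0 !andbT !subn_eq0 !eqn_leq => /andP.
  by rewrite cards1; apply/val_inj.
have A3 : (3 %| #|A|)%N.
  (* Choosing the pair itself outside [A] makes the rotation a total function. *)
  have rotP (ij : 'I_(2 * L).+1 * 'I_(2 * L).+1) : exists kl,
      ij \in A -> rot_spec L (val ij.1, val ij.2) (val kl.1, val kl.2) /\ kl \in A.
    case: (boolP (ij \in A)) => [|_]; last by exists ij.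
    case: ij => i j; rewrite inE /q /= => /andP[ev /eqP qn].
    have [k [l [rkl kL lL evkl qkl]]] := rot_exists le_nL ev qn.
    exists (Ordinal (kL : k < (2 * L).+1)%N, Ordinal (lL : l < (2 * L).+1)%N) => _.
    by split=> //; rewrite inE /q /= evkl qkl eqxx.
  have [f fP] := fin_all_exists rotP.
  apply: (@dvd3_card_free _ f) => ij ijA; have [r1 A1] := fP _ ijA => //.
    have [r2 A2] := fP _ A1; have [r3 A3] := fP _ A2; apply/eqP.
    case: r1 r2 r3 => /= + + [/= + + [/=]]; rewrite -pair_eqE /= -!val_eqE /=; lia.
  apply: contraTneq n_gt0 => fij; rewrite fij in r1; case: r1 => /= r1 r2.
  move: ijA; rewrite inE /q => /andP[_ /eqP <-].
  have [-> ->] : val ij.1 = L /\ val ij.2 = L by clear -r1 r2; rewrite /=; lia.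
  by rewrite subnn.
rewrite -[_ *+ #|A|]mulr_natr; move: A3; rewrite (dvdn_pcharf (pchar_Fp (isT : prime 3))) => /eqP ->.
by rewrite mulr0 oppr0.
Qed.

(** * Exponents divisible by 3 *)

Lemma theta1E (F : fieldType) L : theta L 1 = 1 + \sum_(k < L) 2 *: 'X^(k.+1 ^ 2) :> {poly F}.
Proof.
elim: L => [|L IHL]; first by rewrite /theta big_ord1 big_ord0 scale1r addr0.
rewrite big_ord_recr addrA -{}IHL /theta (_ : (2 * L.+1).+1 = (2 * L).+3)%N; last by lia.
rewrite big_ord_recl big_ord_recr /= !expr1n !scale1r /bump /= (_ : (1 + (2 * L).+1 - L.+1 + (L.+1 - (1 + (2 * L).+1)) = L.+1)%N); last by lia.
under eq_bigr => i _ do rewrite add1n !subSS !expr1n scale1r.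
under [in RHS]eq_bigr => i _ do rewrite expr1n scale1r.
by rewrite add0n subn0 scaler_nat mulr2n; ring.
Qed.

Definition is_sqr n := [exists k : 'I_n.+1, (k ^ 2 == n)%N].

Lemma is_sqrP n : reflect (exists k, k ^ 2 = n)%N (is_sqr n).
Proof.
apply: (iffP existsP) => -[k]; first by move/eqP; exists k.
move=> kn; have lt_kn : (k < n.+1)%N by rewrite ltnS -kn; case: (k) => // m; rewrite leq_pmulr.
by exists (Ordinal lt_kn); apply/eqP.
Qed.

Lemma coef_theta1 (F : fieldType) L n : (n <= L)%N ->
  (theta L 1 : {poly F})`_n = if n == 0%N then 1 else if is_sqr n then 2 else 0.
Proof.
move=> le_nL; rewrite theta1E coefD coef1 coef_sum.
under eq_bigr => k _ do rewrite coefZ coefXn.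
case: (posnP n) => [-> | n_gt0].
  by rewrite big1 ?addr0 // => k _; rewrite eq_sym expn_eq0 mulr0.
rewrite add0r; case: is_sqrP => [[[|k] kn] | nsq].
- by rewrite -kn in n_gt0.
- have lt_kL : (k < L)%N by apply: leq_trans le_nL; rewrite -kn leq_pmulr.
  rewrite (bigD1 (Ordinal lt_kL)) //= -kn eqxx mulr1 big1 ?addr0 // => i.
  by rewrite -val_eqE /= eqn_exp2r // eqSS eq_sym => /negPf->; rewrite mulr0.
- rewrite big1 // => k _; case: eqP => [nk|]; last by rewrite mulr0.
  by case: nsq; exists k.+1.
Qed.

Lemma sum_mul3 (V : zmodType) (f : nat -> V) n :
    (forall k, (k <= 3 * n)%N -> ~~ (3 %| k)%N -> f k = 0) ->
  \sum_(k < (3 * n).+1) f k = \sum_(j < n.+1) f (3 * j)%N.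
Proof.
elim: n => [|n IHn] f0; first by rewrite !big_ord1.
rewrite [RHS]big_ord_recr /= -IHn => [|k le_k]; last by apply: f0; lia.
rewrite (_ : (3 * n.+1).+1 = (3 * n).+4)%N; last by lia.
rewrite 3!big_ord_recr /= (f0 (3 * n).+1) ?(f0 (3 * n).+2) ?addr0; try by lia.
by rewrite (_ : (3 * n.+1) = (3 * n).+3)%N; last lia.
Qed.

(** A square 3m has the form 9 l^2, so the exponents divisible by 3 in a(q) form a(q^9); in terms of
    m this is a(q^3) = a^3. *)
Lemma coef_theta1_mul3 L m : (3 * m <= L)%N ->
  (theta L 1 : {poly 'F_3})`_(3 * m) = (theta L 1 ^+ 3)`_m.
Proof.
move=> le_mL; rewrite cube_polyF3 coef_comp_poly_Xn // (@coef_theta1 _ L (3 * m)) //.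
have sq3 k n : (k ^ 2 = 3 * n)%N -> exists2 l, k = (3 * l)%N & (n = 3 * l ^ 2)%N.
  move=> kn; have /dvdnP[l kE] : (3 %| k)%N.
    by have := Euclid_dvdX k 2 (isT : prime 3); rewrite kn dvdn_mulr // andbT.
  by exists l; [lia | move: kn; rewrite kE; lia].
case dv: (3 %| m)%N; last first.
  have m_neq0 : m != 0%N by case: (m) dv.
  rewrite muln_eq0 /= (negPf m_neq0) ifN //.
  apply/negP => /is_sqrP[k /sq3[l _ mE]].
  by rewrite mE dvdn_mulr in dv.
have /dvdnP[e me] := dv.
rewrite me mulnK // coef_theta1; last by lia.
  rewrite !muln_eq0 /= orbF.
  suff -> : is_sqr (3 * (e * 3)) = is_sqr e by [].
  apply/is_sqrP/is_sqrP => -[k kE].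
    by have [l _ ?] := sq3 _ _ kE; exists l; lia.
  by exists (3 * k)%N; rewrite expnMn kE; lia.
Qed.

Lemma coef_theta1_mod3 L m : (m <= L)%N -> (m %% 3 = 2)%N -> (theta L 1 : {poly 'F_3})`_m = 0.
Proof.
move=> le_mL m3; rewrite coef_theta1 //.
case: is_sqrP => [[k kE]|_]; last by case: m {le_mL} m3.
have : (k %% 3 < 3)%N by rewrite ltn_mod.
move: m3; rewrite -kE -modnXm; by case: (k %% 3)%N => [|[|[|]]].
Qed.

(** The operator usually written U_3; [size p] is merely a safe degree bound. *)
Definition trisect (R : nzRingType) (p : {poly R}) : {poly R} := \poly_(i < size p) p`_(3 * i).

Lemma coef_trisect (R : nzRingType) (p : {poly R}) i : (trisect p)`_i = p`_(3 * i).
Proof.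
rewrite coef_poly; case: ltnP => // le_pi.
by rewrite nth_default // (leq_trans le_pi) // leq_pmull.
Qed.

Lemma trisectD (R : nzRingType) (p q : {poly R}) : trisect (p + q) = trisect p + trisect q.
Proof. by apply/polyP => i; rewrite !(coefD, coef_trisect). Qed.

Lemma trisectMcube (p q : {poly 'F_3}) : trisect (p * q ^+ 3) = trisect p * q.
Proof.
apply/polyP => i; rewrite coef_trisect !coefMr cube_polyF3.
rewrite (@sum_mul3 _ (fun j => p`_(3 * i - j) * (q \Po 'X^3)`_j)) => [|k _ /negPf nk].
  by apply: eq_bigr => j _; rewrite coef_comp_poly_Xn // dvdn_mulr // mulKn // -mulnBr coef_trisect.
by rewrite coef_comp_poly_Xn // nk mulr0.
Qed.

Lemma eqX_trisect n (p q : {poly 'F_3}) :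
  eqX (3 * n).+1 p q -> eqX n.+1 (trisect p) (trisect q).
Proof.
by move=> /eqXP pq; apply/eqXP => i lt_in; rewrite !coef_trisect pq // ltnS leq_mul2l.
Qed.

(** If k + l is divisible by 3 but k is not, one of k, l is 2 mod 3 and its theta coefficient
    vanishes; only products of exponents divisible by 3 survive. *)
Lemma trisect_theta_sqr n :
  eqX n.+1 (trisect (theta (3 * n) 1 ^+ 2)) ((theta (3 * n) (1 : 'F_3) ^+ 2) ^+ 3).
Proof.
apply/eqXP => m; rewrite ltnS => le_mn; set t := theta _ _.
rewrite coef_trisect exprAC [in RHS]expr2 [in LHS]expr2 !coefM.
rewrite (@sum_mul3 _ (fun j => t`_j * t`_(3 * m - j))) => [|k le_k nk].
  apply: eq_bigr => j _; have le_jm : (j <= m)%N by rewrite -ltnS.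
  by rewrite -mulnBr !coef_theta1_mul3 //; lia.
have [k2 | k2] : (k %% 3 = 2)%N \/ ((3 * m - k) %% 3 = 2)%N by lia.
  by rewrite coef_theta1_mod3 ?mul0r //; lia.
by rewrite mulrC coef_theta1_mod3 ?mul0r //; lia.
Qed.

(** Used with c = a^2. The relation is scaled so that g is multiplied by a cube, through which
    trisection passes: no inverse series is needed, only a final cancellation of c. *)
Lemma trisect_solve n (g c : {poly 'F_3}) : c`_0 != 0 ->
    eqX (3 * n).+1 (g * c ^+ 3 + (c + c ^+ 3)) 0 ->
    eqX n.+1 (trisect c) (c ^+ 3) ->
  eqX n.+1 (trisect g) (- (1 + c ^+ 2)).
Proof.
move=> c0 /eqX_trisect gc cc; apply: (eqXMI c0).
have t0 : trisect (0 : {poly 'F_3}) = 0 by apply/polyP => i; rewrite coef_trisect !coefE.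
have t1 : trisect (c ^+ 3) = c.
  rewrite -[c ^+ 3]mul1r trisectMcube (_ : trisect 1 = 1) ?mul1r //.
  by apply/polyP => i; rewrite coef_trisect !coefE muln_eq0.
rewrite trisectD (trisectD c) trisectMcube t0 t1 in gc.
have := dvdp_sub gc cc; rewrite /eqX; congr (_ %| _); ring.
Qed.

(** * The generating function of S9 *)

Section SeriesMod3.
Variable L : nat.
Implicit Types f g : nat -> int.

Definition poly_of f : {poly 'F_3} := \poly_(i < L.+1) (f i)%:~R.

Lemma poly_of_mul f g : eqX L.+1 (poly_of (smul f g)) (poly_of f * poly_of g).
Proof.
apply/eqXP => n lt_nL; rewrite coef_poly lt_nL coefM /smul rmorph_sum /=.
apply: eq_bigr => i _; rewrite !coef_poly rmorphM /=.
by rewrite (leq_trans (ltn_ord i) lt_nL) (leq_ltn_trans (leq_subr _ _) lt_nL).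
Qed.

Lemma eqX_poly_of f g : (forall n, (n <= L)%N -> f n = g n) -> eqX L.+1 (poly_of f) (poly_of g).
Proof. by move=> fg; apply/eqXP => n lt_nL; rewrite !coef_poly lt_nL fg. Qed.

Lemma poly_of_one : poly_of (@sone int) = 1.
Proof.
apply/polyP => n; rewrite coef_poly coef1 /sone; case: n => [|n] //.
by rewrite if_same.
Qed.

Lemma poly_of_binom (c : int) m : eqX L.+1 (poly_of (sbinom c m)) (1 + c%:~R *: 'X^m).
Proof.
apply/eqXP => n lt_nL; rewrite coef_poly lt_nL coefD coef1 coefZ coefXn /sbinom.
by rewrite rmorphD rmorphM !rmorph_nat.
Qed.

Lemma poly_of_div f g : g 0%N \is a GRing.unit ->
  eqX L.+1 (poly_of (sdiv f g) * poly_of g) (poly_of f).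
Proof.
move=> Ug; apply: eqX_trans (eqXM (poly_of_mul _ _) (eqX_refl _ _)) _.
rewrite -mulrA -[X in eqX _ _ X]mulr1; apply: eqXM (eqX_refl _ _) _.
rewrite mulrC; apply: eqX_trans (eqX_sym (poly_of_mul _ _)) _.
by rewrite -poly_of_one; apply: eqX_poly_of => n _; apply: smulV.
Qed.

Lemma poly_of_partial (F : nat -> nat -> int) N :
  eqX L.+1 (poly_of (spartial F N)) (\prod_(k < N) poly_of (F k.+1)).
Proof.
elim: N => [|N IHN] /=; first by rewrite big_ord0 poly_of_one eqX_refl.
by rewrite big_ord_recr; apply: eqX_trans (poly_of_mul _ _) (eqXM IHN (eqX_refl _ _)).
Qed.

End SeriesMod3.

Lemma sprod_partial (R : comUnitRingType) (F : nat -> nat -> R) n N :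
  (forall k, (0 < k)%N -> near1 k (F k)) -> (n <= N)%N -> sprod F n = spartial F N n.
Proof.
move=> F1 /subnK<-; elim: (N - n)%N => // d IHd.
by rewrite addSn /= (smul_near1r _ (F1 _ _)) // ltnS leq_addl.
Qed.

Lemma odd_prod_exp9 L (z : 'F_3) :
  odd_prod L z ^+ 9 = \prod_(j < L) (1 + z *: 'X^(9 * (2 * j + 1))).
Proof.
rewrite (exprM _ 3 3) -!prodrXl; apply: eq_bigr => j _.
rewrite !cubeDF3 !expr1n !exprZn !cubeF3 -!exprM.
by congr (_ + _ *: 'X^_); lia.
Qed.

Lemma odd_prod_coef0 (F : fieldType) L (z : F) : (odd_prod L z)`_0 = 1.
Proof.
rewrite -horner_coef0 horner_prod big1 // => j _.
by rewrite hornerD hornerC hornerZ hornerXn addn1 expr0n mulr0 addr0.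
Qed.

Lemma S9_odd_prod L :
  eqX L.+1 (poly_of L S9 * odd_prod L 1 ^+ 8) (odd_prod L (-1) ^+ 8).
Proof.
set Pp := odd_prod L 1; set Pm := odd_prod L (-1).
(* This factor produces ninth powers, that is the products over 1 + q^(9m) and 1 - q^(9m), so the
   claim can be checked factor by factor. *)
apply: (@eqXMI _ _ (Pp * Pm)).
  by rewrite -horner_coef0 hornerM !horner_coef0 !odd_prod_coef0 mulr1 oner_eq0.
rewrite (_ : Pp * Pm * (_ * _) = poly_of L S9 * (Pp ^+ 9 * Pm)); last by ring.
rewrite (_ : Pp * Pm * _ = Pp * Pm ^+ 9); last by ring.
have S9E : eqX L.+1 (poly_of L S9) (\prod_(k < L) poly_of L (S9_factor k.+1)).
  apply: eqX_trans (poly_of_partial _ _ _); apply: eqX_poly_of => n.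
  exact: sprod_partial S9_factor_near1.
apply: eqX_trans (eqXM S9E (eqX_refl _ _)) _.
rewrite !odd_prod_exp9 /Pp /Pm /odd_prod -!big_split /=; apply: eqX_prod => k _.
have mE : (2 * k.+1 - 1 = 2 * k + 1)%N by lia.
have binom2 c d m m' : eqX L.+1 (poly_of L (smul (sbinom c m) (sbinom d m')))
    ((1 + c%:~R *: 'X^m) * (1 + d%:~R *: 'X^m')).
  by apply: eqX_trans (poly_of_mul _ _ _) (eqXM (poly_of_binom _ _ _) (poly_of_binom _ _ _)).
rewrite /S9_factor mE.
apply: eqX_trans (eqXM (eqX_refl _ _) (eqX_sym (binom2 1 (-1) _ _))) _.
apply: eqX_trans (poly_of_div _ _ _) (binom2 _ _ _ _).
by rewrite /smul big_ord1 /sbinom !(eq_sym 0%N) muln_eq0 addn1 /= !mulr0 !addr0 mulr1 unitr1.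
Qed.

Lemma S9_theta L :
  eqX L.+1 (poly_of L S9 * theta L 1 ^+ 4) (theta L (-1) ^+ 4).
Proof.
set E := \prod_(j < 2 * L) (1 - 'X^2 ^+ j.+1) : {poly 'F_3}.
have jtp z : z ^+ 2 = 1 -> eqX L.+1 (E ^+ 4 * odd_prod L z ^+ 8) (theta L z ^+ 4).
  move=> z2; have := eqX_exp 4 (eqX_triple_product L z2).
  have zL4 : (z ^+ L) ^+ 4 = 1 by rewrite exprAC (exprM z 2 2) z2 !expr1n.
  by rewrite exprMn exprZn zL4 scale1r -exprM.
have sqrN1 : (-1 : 'F_3) ^+ 2 = 1 by rewrite sqrrN expr1n.
apply: eqX_trans _ (jtp _ sqrN1).
apply: eqX_trans (eqXM (eqX_refl _ _) (eqX_sym (jtp 1 (expr1n _ _)))) _.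
rewrite mulrCA; exact: eqXM (eqX_refl _ _) (S9_odd_prod L).
Qed.

Lemma S9_mul3 n : (0 < n)%N ->
  (S9 (3 * n))%:~R = - (theta (3 * n) (1 : 'F_3) ^+ 4)`_n.
Proof.
move=> n_gt0; set a := theta (3 * n) 1.
have c0 : (a ^+ 2)`_0 != 0.
  by rewrite -horner_coef0 horner_exp horner_coef0 coef_theta1 //= expr1n oner_eq0.
have gc : eqX (3 * n).+1
    (poly_of (3 * n) S9 * (a ^+ 2) ^+ 3 + (a ^+ 2 + (a ^+ 2) ^+ 3)) 0.
  (* Adding the two congruences eliminates b^4 and gives G a^4 + a^4 + 1 = 0; the factor a^2 turns
     a^4 into the cube of a^2. *)
  have := dvdp_mull (a ^+ 2) (dvdp_add (S9_theta (3 * n)) (theta_exp4D (3 * n))).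
  by rewrite /eqX subr0; congr (_ %| _); rewrite -/a; ring.
have /eqXP/(_ n (ltnSn n)) := trisect_solve c0 gc (trisect_theta_sqr n).
rewrite coef_trisect coef_poly ltnSn => ->.
by rewrite coefN coefD coef1 (gtn_eqF n_gt0) add0r -exprM.
Qed.

(** * Vanishing modulo 3 *)

Lemma S9_mul3_eq0 n : (forall x y, x ^ 2 + 3 * y ^ 2 != n)%N -> (S9 (3 * n) = 0 %[mod 3])%Z.
Proof.
move=> nrep; have n_gt0 : (0 < n)%N by rewrite lt0n eq_sym; apply: (nrep 0%N 0%N).
suff : (S9 (3 * n))%:~R = 0 :> 'F_3.
  by move/eqP; rewrite -(dvdz_pcharf (pchar_Fp (isT : prime 3))) => /dvdz_mod0P ->.
rewrite S9_mul3 // theta_exp4 coef_sum big1 ?oppr0 // => ij _.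
by rewrite coefZ coefXn eq_sym (negPf (nrep _ _)) mulr0.
Qed.

Theorem theorem3p5 (p alpha n i : nat) (p_prime : prime p)
    (p_mod6 : (p = 5 %[mod 6])%N) (i_gt0 : (1 <= i)%N)
    (i_ltp : (i <= p - 1)%N) :
  (S9 (6 * p ^ (2 * alpha + 2) * n + (6 * i + 3 * p) * p ^ (2 * alpha + 1))%N
     = 0 %[mod 3])%Z.
Proof.
have -> : (6 * p ^ (2 * alpha + 2) * n + (6 * i + 3 * p) * p ^ (2 * alpha + 1) =
    3 * (p ^ (2 * alpha + 1) * (2 * p * n + 2 * i + p)))%N.
  by rewrite (addnS _ 1) expnS; ring.
apply: S9_mul3_eq0 => x y; apply: not_sqr_add3sqr => //.
have p_gt4 : (4 < p)%N by move: (leq_mod p 6); rewrite p_mod6.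
(* Modulo p the cofactor is 2i, which is nonzero as 0 < i < p and p > 2. *)
rewrite dvdn_addl // -mulnA mulnCA dvdn_addr ?(dvdn_mulr (2 * n) (dvdnn p)) // Euclid_dvdM //.
by rewrite !gtnNdvd //; lia.
Qed.
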